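(* Let $p$ be a prime and $\mathcal{U}=\mathrm{PSL}(2,\mathcal{O}_p)$. For any $p$-adic Möbius map $g\in\mathrm{PSL}(2,\mathbb{C}_p)$: $d(g,\mathcal{U})=0$ if $g\in\mathcal{U}$, and $d(g,\mathcal{U})=1$ if $g\notin\mathcal{U}$.
   Context: $\mathbb{C}_p$ is the completion of the algebraic closure of $\mathbb{Q}_p$; $\mathcal{O}_p=\{z\in\mathbb{C}_p:|z|\le1\}$. A $p$-adic Möbius map is an element of $\mathrm{PSL}(2,\mathbb{C}_p)=\mathrm{SL}(2,\mathbb{C}_p)/\{\pm I\}$, acting on $\mathbb{P}^1(\mathbb{C}_p)=\mathbb{C}_p\cup\{\infty\}$ by $z\mapsto\frac{az+b}{cz+d}$. $\mathrm{PSL}(2,\mathcal{O}_p)$ is the subgroup of those elements whose lifts to $\mathrm{SL}(2,\mathbb{C}_p)$ have all entries in $\mathcal{O}_p$. Chordal metric: $\rho_v(z,w)=\frac{|z-w|}{\max\{1,|z|\}\max\{1,|w|\}}$ for $z,w\in\mathbb{C}_p$, $\rho_v(\infty,w)=\rho_v(w,\infty)=\frac1{\max\{1,|w|\}}$ for $w\in\mathbb{C}_p$, $\rho_v(\infty,\infty)=0$. For Möbius maps $g,h$, $\rho_0(g,h)=\sup_{z\in\mathbb{P}^1(\mathbb{C}_p)}\rho_v(g(z),h(z))$, and $d(g,\mathcal{U})=\inf\{\rho_0(g,u):u\in\mathcal{U}\}$. *)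

(* Defs.v *)
From HB Require Import structures.
From mathcomp Require Import all_boot all_order all_algebra.
From mathcomp Require Import generic_quotient.
From mathcomp Require Import boolp classical_sets reals.

Set Implicit Arguments.
Unset Strict Implicit.
Unset Printing Implicit Defensive.

Import Order.TTheory GRing.Theory Num.Theory.
Local Open Scope classical_set_scope.
Local Open Scope ring_scope.
Local Open Scope quotient_scope.

Section AbsoluteValues.
Variable R : realType.

Record nonarch_abs (K : fieldType) (v : K -> R) : Prop := NonarchAbs {
  nabs_ge0 : forall x, 0 <= v x;
  nabs_eq0 : forall x, v x = 0 <-> x = 0;
  nabsM : forall x y, v (x * y) = v x * v y;
  nabsD : forall x y, v (x + y) <= Num.max (v x) (v y)
}.

Definition abs_complete (K : fieldType) (v : K -> R) : Prop :=
  forall u : nat -> K,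
    (forall e : R, 0 < e -> exists N : nat, forall m n : nat,
       (N <= m)%N -> (N <= n)%N -> v (u m - u n) < e) ->
    exists l : K, forall e : R, 0 < e -> exists N : nat, forall n : nat,
      (N <= n)%N -> v (u n - l) < e.

Definition abs_extends (K L : fieldType) (f : {rmorphism K -> L})
  (v : K -> R) (w : L -> R) : Prop := forall x, w (f x) = v x.

Record is_completion (K L : fieldType) (f : {rmorphism K -> L})
  (v : K -> R) (w : L -> R) : Prop := IsCompletion {
  completion_abs : nonarch_abs w;
  completion_extends : abs_extends f v w;
  completion_dense : forall (y : L) (e : R), 0 < e ->
    exists x : K, w (y - f x) < e;
  completion_complete : abs_complete w
}.

Record is_algebraic_closure (K L : fieldType) (f : {rmorphism K -> L}) : Prop :=
  IsAlgebraicClosure {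
  closure_closed : GRing.closed_field_axiom L;
  closure_algebraic : forall y : L, algebraicOver f y
}.

(* For x != 0 this is p ^ (- v_p x). *)
Definition padic_abs (p : nat) (x : rat) : R :=
  if x == 0 then 0
  else (p%:R : R) ^ ((logn p `|denq x|)%:Z - (logn p `|numq x|)%:Z).

(* The completion of the algebraic closure of the completion of rat for the
   p-adic absolute value. Each of the three steps is given by its defining
   property, which determines the valued field up to isometric isomorphism
   (an absolute value on a complete field has only one extension to an
   algebraic closure). *)
Definition is_padic_complex (p : nat) (Cp : fieldType) (abs : Cp -> R) : Prop :=
  exists (Qp : fieldType) (absQp : Qp -> R) (i : {rmorphism rat -> Qp}),
    is_completion i (padic_abs p) absQp /\
  exists (Qpbar : fieldType) (absQpbar : Qpbar -> R)
         (j : {rmorphism Qp -> Qpbar}),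
    [/\ is_algebraic_closure j,
        nonarch_abs absQpbar,
        abs_extends j absQp absQpbar
      & exists k : {rmorphism Qpbar -> Cp}, is_completion k absQpbar abs].

End AbsoluteValues.

Section PSL2.
Variable C : fieldType.

Definition SL2 : choiceType := {A : 'M[C]_2 | \det A == 1}.

Definition SL2_eqpm (A B : SL2) : bool :=
  (val A == val B) || (val A == - val B).

Lemma SL2_eqpm_equiv : equiv_class_of SL2_eqpm.
Proof.
split=> [A|A B|B A D]; rewrite /SL2_eqpm ?eqxx //.
  by rewrite eq_sym; congr (_ || _); rewrite eq_sym eqr_oppLR.
by move=> /orP[] /eqP ->; rewrite // eqr_oppLR eqr_opp orbC.
Qed.

Canonical SL2_eqpm_rel := EquivRelPack SL2_eqpm_equiv.

Definition PSL2 : choiceType := {eq_quot SL2_eqpm_rel}.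

Definition to_PSL2 (A : SL2) : PSL2 := \pi_({eq_quot SL2_eqpm_rel}) A.

(* P^1(C) = C together with None, the point at infinity. *)
Definition P1 := option C.

Definition mobius (A : 'M[C]_2) (z : P1) : P1 :=
  let a := A 0 0 in let b := A 0 1 in let c := A 1 0 in let d := A 1 1 in
  match z with
  | Some z => if c * z + d == 0 then None else Some ((a * z + b) / (c * z + d))
  | None => if c == 0 then None else Some (a / c)
  end.

Lemma mobiusN (A : 'M[C]_2) : mobius (- A) =1 mobius A.
Proof.
case=> [z|] /=; rewrite !mxE.
  rewrite !mulNr -!opprD oppr_eq0; case: ifP => // _.
  by rewrite invrN mulrNN.
by rewrite oppr_eq0; case: ifP => // _; rewrite invrN mulrNN.
Qed.

(* [repr] selects a lift to SL2; by [PSL2_actE] the choice is irrelevant. *)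
Definition PSL2_act (g : PSL2) : P1 -> P1 := mobius (val (repr g)).

Lemma to_PSL2_eq (A B : SL2) :
  to_PSL2 A = to_PSL2 B <-> val A = val B \/ val A = - val B.
Proof.
split=> [/eqmodP/orP[]/eqP|h]; [by left|by right|].
by apply/eqmodP/orP; case: h => ->; [left|right]; rewrite eqxx.
Qed.

Lemma PSL2_actE (A : SL2) : PSL2_act (to_PSL2 A) =1 mobius (val A).
Proof.
move=> z; rewrite /PSL2_act.
have /to_PSL2_eq : to_PSL2 (repr (to_PSL2 A)) = to_PSL2 A by exact: reprK.
by case=> ->; rewrite ?mobiusN.
Qed.

End PSL2.

Section Chordal.
Variables (R : realType) (C : fieldType) (abs : C -> R).

Definition chordal (z w : P1 C) : R :=
  match z, w with
  | Some z, Some w => abs (z - w) / (Num.max 1 (abs z) * Num.max 1 (abs w))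
  | None, Some w => (Num.max 1 (abs w))^-1
  | Some z, None => (Num.max 1 (abs z))^-1
  | None, None => 0
  end.

(* The values of [chordal] lie in [0, 1] when [abs] is a nonarchimedean
   absolute value ([chordal_ge0], [chordal_le1]), so the real-valued [sup] and
   [inf] below are taken over nonempty bounded sets. *)
Definition rho0 (g h : PSL2 C) : R :=
  sup [set chordal (PSL2_act g z) (PSL2_act h z) | z in [set: P1 C]].

Definition PSL2O : set (PSL2 C) :=
  [set g | forall A : SL2 C, to_PSL2 A = g ->
             forall i j : 'I_2, abs (val A i j) <= 1].

Definition dist_to (g : PSL2 C) (U : set (PSL2 C)) : R :=
  inf [set rho0 g u | u in U].

Hypothesis habs : nonarch_abs abs.

Lemma chordal_ge0 z w : 0 <= chordal z w.
Proof.
have m0 x : 0 <= Num.max 1 (abs x) by rewrite le_max ler01.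
by case: z w => [z|] [w|] //=; rewrite ?invr_ge0 // divr_ge0 ?mulr_ge0 //;
  exact: nabs_ge0 habs _.
Qed.

Lemma nabs1 : abs 1 = 1.
Proof.
have n1 : abs 1 != 0.
  by apply/eqP => /(nabs_eq0 habs) /eqP; rewrite oner_eq0.
by apply: (mulfI n1); rewrite -(nabsM habs) !mulr1.
Qed.

Lemma nabsN x : abs (- x) = abs x.
Proof.
have : abs (-1) ^+ 2 == 1 by rewrite expr2 -(nabsM habs) mulrNN mulr1 nabs1.
rewrite sqrp_eq1 ?(nabs_ge0 habs) // => /eqP h.
by rewrite -mulN1r (nabsM habs) h mul1r.
Qed.

Lemma chordal_le1 z w : chordal z w <= 1.
Proof.
have m1 x : 1 <= Num.max 1 (abs x) by rewrite le_max lexx.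
have m0 x : 0 < Num.max 1 (abs x) by exact: lt_le_trans ltr01 (m1 x).
case: z w => [z|] [w|] //=; rewrite ?invf_le1 //.
rewrite ler_pdivrMr ?mulr_gt0 // mul1r.
apply: (le_trans (nabsD habs _ _)); rewrite nabsN ge_max; apply/andP; split.
  by apply: (@le_trans _ _ (Num.max 1 (abs z)));
    rewrite ?le_max ?lexx ?orbT // ler_peMr // ltW.
by apply: (@le_trans _ _ (Num.max 1 (abs w)));
  rewrite ?le_max ?lexx ?orbT // ler_peMl // ltW.
Qed.

End Chordal.

(* Main.v *)
Require Import Defs.
From mathcomp Require Import all_boot all_order all_algebra.
From mathcomp Require Import boolp classical_sets reals.
From mathcomp Require Import ring.
Local Open Scope ring_scope.

(** Write a point of the projective line as the class of a nonzero column
    vector. With the maximum norm on vectors the chordal distance between the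
    classes of [x] and [y] is [|x /\ y| / (||x|| ||y||)], where [/\ ] is the
    determinant of the two columns ([chordal_proj]). An integral matrix of
    determinant 1 preserves both the norm and the determinant, hence acts by
    chordal isometries ([chordal_integral_isometry]). So, for [u] in
    PSL(2, O) with lift [B] and [g] with lift [A], the distance [rho0 g u] is
    the supremum of the displacement of the matrix [M := B^-1 A], which is
    integral exactly when [A] is.

    The key fact is that a nonintegral matrix [M] of determinant 1 moves one of
    the points oo, 0, 1 by the maximal distance 1
    ([nonintegral_displacement]). The reason is reduction to the residue field:
    after division by an entry of largest absolute value, [M] reduces to a
    matrix of determinant 0, that is of rank 1, which sends every point outside
    its kernel to one single point. Two points have chordal distance 1 when
    their reductions differ, so it suffices to find a point whose reduction is
    neither the kernel nor the image of the reduced matrix; the projective line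
    over any field has the three points oo, 0, 1, which is enough to avoid two.
    Therefore [rho0 g u = 1] for every [u] in PSL(2, O) as soon as [g] is
    outside, while [rho0 g g = 0] when it is inside. The proof of
    [nonintegral_entries] carries out this reduction argument as a comparison
    of absolute values of the entries, with the ultrametric inequality in the
    form of [absD_dominant]. *)

Set Implicit Arguments.
Unset Strict Implicit.
Unset Printing Implicit Defensive.

Import Order.TTheory GRing.Theory Num.Theory.
Local Open Scope classical_set_scope.

Lemma big_ord2 (C : fieldType) (F : 'I_2 -> C) :
  \sum_(i < 2) F i = F 0 + F 1.
Proof. by rewrite !big_ord_recl big_ord0 addr0; congr (_ + F _); apply: val_inj. Qed.

Lemma det_mx22 (C : fieldType) (A : 'M[C]_2) :
  \det A = A 0 0 * A 1 1 - A 0 1 * A 1 0.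
Proof.
rewrite (expand_det_row _ 0) big_ord2 /cofactor !det_mx11 !mxE /=.
rewrite expr0 expr1 mul1r mulN1r mulrN.
by congr (_ * A _ _ - _ * A _ _); apply: val_inj.
Qed.

(** * Homogeneous coordinates on the projective line *)

Section Homogeneous.
Variable C : fieldType.
Implicit Types (x y : 'cV[C]_2) (A : 'M[C]_2).

Definition colvec (s t : C) : 'cV[C]_2 := \col_i (if i == 0 then s else t).

Definition proj x : P1 C :=
  if x 1 0 == 0 then None else Some (x 0 0 / x 1 0).

Definition wedge x y : C := x 0 0 * y 1 0 - x 1 0 * y 0 0.

Lemma mulmx2E A x i : (A *m x) i 0 = A i 0 * x 0 0 + A i 1 * x 1 0.
Proof. by rewrite mxE big_ord2. Qed.

Lemma cV2_neq0 x : x != 0 -> (x 0 0 != 0) || (x 1 0 != 0).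
Proof.
apply: contraR; rewrite negb_or !negbK => /andP[/eqP x0 /eqP x1].
apply/eqP/colP => i; rewrite mxE.
by case: i => [[|[|[]]]] //= h;
  [rewrite -x0|rewrite -x1]; congr (x _ _); apply: val_inj.
Qed.

Lemma colvec_neq0 s t : (s != 0) || (t != 0) -> colvec s t != 0.
Proof.
apply: contraL => /eqP/colP e.
by move: (e 0) (e 1); rewrite !mxE /= => -> ->; rewrite eqxx.
Qed.

Lemma mobius_proj A x : x != 0 -> mobius A (proj x) = proj (A *m x).
Proof.
move=> /cV2_neq0 x0; rewrite /proj !mulmx2E.
case: (eqVneq (x 1 0) 0) x0 => [-> | x1 _] /=.
  rewrite orbF !mulr0 !addr0 => x0.
  by rewrite mulf_eq0 (negPf x0) orbF -mulf_div divff // mulr1.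
have e i : A i 0 * (x 0 0 / x 1 0) + A i 1
  = (A i 0 * x 0 0 + A i 1 * x 1 0) / x 1 0 by field.
rewrite !e.
rewrite mulf_eq0 invr_eq0 (negPf x1) orbF.
case: eqP => // /eqP y1; congr Some.
by rewrite invf_div mulrA mulrVK ?unitfE.
Qed.

Lemma wedge_mulmx A x y : wedge (A *m x) (A *m y) = \det A * wedge x y.
Proof. by rewrite /wedge !mulmx2E det_mx22; ring. Qed.

Lemma det1_mulmx_neq0 A x : \det A = 1 -> x != 0 -> A *m x != 0.
Proof.
move=> detA; apply: contra => /eqP Ax0.
have unitA : A \in unitmx by rewrite unitmxE detA unitr1.
by rewrite -(mulKmx unitA x) Ax0 mulmx0.
Qed.

End Homogeneous.

(** * Chordal geometry for a nonarchimedean absolute value *)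

Section Nonarchimedean.
Variables (R : realType) (C : fieldType) (abs : C -> R).
Hypothesis habs : nonarch_abs abs.
Implicit Types (x y : 'cV[C]_2) (A B M : 'M[C]_2).

Let abs_ge0 := nabs_ge0 habs.
Let absM := nabsM habs.
Let absN := nabsN habs.
Let abs1 := nabs1 habs.

Lemma abs0 : abs 0 = 0. Proof. exact/(nabs_eq0 habs). Qed.

Lemma abs_gt0 (s : C) : s != 0 -> 0 < abs s.
Proof.
move=> s0; rewrite lt_def abs_ge0 andbT; apply: contra s0.
by move=> /eqP/(nabs_eq0 habs)/eqP.
Qed.

Lemma absD_le (s t : C) (r : R) : abs s <= r -> abs t <= r -> abs (s + t) <= r.
Proof. by move=> hs ht; apply: le_trans (nabsD habs _ _) _; rewrite ge_max hs. Qed.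

Lemma absD_lt (s t : C) (r : R) : abs s < r -> abs t < r -> abs (s + t) < r.
Proof. by move=> hs ht; apply: le_lt_trans (nabsD habs _ _) _; rewrite gt_max hs. Qed.

(** Every triangle is isosceles: a strictly smaller term cannot change the
    absolute value, since otherwise subtracting it again would leave [s] too
    small. *)
Lemma absD_dominant (s t : C) : abs t < abs s -> abs (s + t) = abs s.
Proof.
move=> lts; apply/eqP; rewrite eq_le absD_le ?(ltW lts) //=.
rewrite leNgt; apply/negP => lt.
by move: lts; rewrite -absN => /(absD_lt lt); rewrite addrK ltxx.
Qed.

Definition integral_mx A : Prop := forall i j, abs (A i j) <= 1.

Definition vnorm x : R := Num.max (abs (x 0 0)) (abs (x 1 0)).

Lemma vnorm_gt0 x : x != 0 -> 0 < vnorm x.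
Proof. by rewrite lt_max => /cV2_neq0/orP[] /abs_gt0 ->; rewrite ?orbT. Qed.

Lemma vnorm_affine x : x 1 0 != 0 ->
  vnorm x = abs (x 1 0) * Num.max 1 (abs (x 0 0 / x 1 0)).
Proof.
by move=> x1; rewrite maxr_pMr // mulr1 -absM mulrCA divff // mulr1 maxC.
Qed.

Lemma vnorm_infinite x : x 1 0 = 0 -> vnorm x = abs (x 0 0).
Proof. by move=> x1; rewrite /vnorm x1 abs0; apply/max_idPl. Qed.

(** In an affine chart the norm factors as [|x1| max(1, |x0 / x1|)], so the
    denominators of the chordal metric are norms up to the factors [|x1|],
    [|y1|] that clear the fractions in [z - w]; both sides are homogeneous of
    degree 0, which also settles the points at infinity. *)
Lemma chordal_proj x y : x != 0 -> y != 0 ->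
  chordal abs (proj x) (proj y) = abs (wedge x y) / (vnorm x * vnorm y).
Proof.
have max_neq0 s : Num.max 1 (abs s) != 0.
  by rewrite gt_eqF // lt_max ltr01.
have abs_neq0 s : s != 0 -> abs s != 0 by move=> /abs_gt0; rewrite lt0r => /andP[].
move=> /cV2_neq0 x0 /cV2_neq0 y0; rewrite /proj /wedge.
have [x1|x1] := eqVneq (x 1 0) 0; have [y1|y1] := eqVneq (y 1 0) 0 => /=.
- by rewrite x1 y1 mulr0 mul0r subr0 abs0 mul0r.
- move: x0; rewrite x1 eqxx orbF => x0.
  rewrite (vnorm_infinite x1) (vnorm_affine y1) mul0r subr0.
  rewrite [abs (x 0 0 * _)]absM.
  by field; rewrite max_neq0 !abs_neq0.
- move: y0; rewrite y1 eqxx orbF => y0.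
  rewrite (vnorm_affine x1) (vnorm_infinite y1) mulr0 sub0r absN.
  rewrite [abs (x 1 0 * _)]absM.
  by field; rewrite max_neq0 !abs_neq0.
- rewrite (vnorm_affine x1) (vnorm_affine y1).
  have -> : x 0 0 * y 1 0 - x 1 0 * y 0 0
    = x 1 0 * y 1 0 * (x 0 0 / x 1 0 - y 0 0 / y 1 0) by field; rewrite x1 y1.
  rewrite [abs (_ * (_ - _))]absM [abs (_ * y 1 0)]absM.
  by field; rewrite !max_neq0 !abs_neq0.
Qed.

(** * Integral matrices act by isometries *)

Lemma integral_mulmx A B : integral_mx A -> integral_mx B -> integral_mx (A *m B).
Proof.
move=> hA hB i j; rewrite mxE big_ord2.
by apply: absD_le; rewrite absM mulr_ile1.
Qed.

Lemma integral_adj A : integral_mx A -> integral_mx (\adj A).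
Proof.
move=> hA i j; rewrite mxE /cofactor.
rewrite det_mx11 !mxE absM.
suff -> : abs ((-1) ^+ (j + i)) = 1 by rewrite mul1r.
by rewrite -signr_odd; case: odd; rewrite ?expr1 ?expr0 ?absN abs1.
Qed.

Lemma vnorm_integral_le A x : integral_mx A -> vnorm (A *m x) <= vnorm x.
Proof.
move=> hA; suff h i : abs ((A *m x) i 0) <= vnorm x by rewrite ge_max !h.
rewrite mulmx2E; apply: absD_le; rewrite absM (le_trans (ler_piMl _ _)) //;
  by rewrite le_max lexx ?orbT.
Qed.

Lemma adj_mulKmx n A (B : 'M[C]_(2, n)) :
  \det A = 1 -> \adj A *m (A *m B) = B.
Proof. by move=> detA; rewrite mulmxA mul_adj_mx detA mul1mx. Qed.

(** The adjugate of [A] is an integral inverse, so [A] can neither increase nor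
    decrease the norm. *)
Lemma vnorm_integral A x : \det A = 1 -> integral_mx A -> vnorm (A *m x) = vnorm x.
Proof.
move=> detA hA; apply/eqP; rewrite eq_le vnorm_integral_le //=.
by rewrite -{1}(adj_mulKmx x detA) vnorm_integral_le //; apply: integral_adj.
Qed.

Lemma chordal_integral_isometry A x y : \det A = 1 -> integral_mx A ->
  x != 0 -> y != 0 ->
  chordal abs (proj (A *m x)) (proj (A *m y)) = chordal abs (proj x) (proj y).
Proof.
move=> detA hA x0 y0; rewrite !chordal_proj ?det1_mulmx_neq0 //.
by rewrite wedge_mulmx detA mul1r !vnorm_integral.
Qed.

(** * Nonintegral matrices have maximal displacement *)

(** The three alternatives say that the point oo, 0 or 1 is moved by chordal
    distance 1. If oo and 0 both fail, then [a] and [d] dominate their columns,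
    so [|ad| = |det| = 1]; unless all entries are integral, one of [a] and [d]
    is then strictly larger than every other entry, and it alone governs both
    sides of the third inequality. *)
Lemma nonintegral_entries (a b c d : C) : a * d - b * c = 1 ->
  ~ (abs a <= 1 /\ abs d <= 1 /\ abs b <= 1 /\ abs c <= 1) ->
  [\/ abs a <= abs c, abs d <= abs b
    | Num.max (abs (a + b)) (abs (c + d)) <= abs (a + b - (c + d))].
Proof.
move=> det1 nonint.
have [|ca] := leP (abs a) (abs c); first by constructor 1.
have [|bd] := leP (abs d) (abs b); first by constructor 2.
constructor 3.
have ad1 : abs a * abs d = 1.
  rewrite -absM -abs1 -det1 [RHS]absD_dominant // absN !absM mulrC.
  by apply: ltr_pM.
have [ad|da|ad] := ltgtP (abs a) (abs d).
- have lt_ab : abs (a + b) < abs d by apply: absD_lt.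
  have cd : abs (c + d) = abs d.
    by rewrite addrC absD_dominant // (lt_trans ca).
  by rewrite -opprB absN [leRHS]absD_dominant ?absN ?cd // ge_max ltW // lexx.
- have ab : abs (a + b) = abs a by rewrite absD_dominant // (lt_trans bd).
  have lt_cd : abs (c + d) < abs a by apply: absD_lt.
  by rewrite [leRHS]absD_dominant ?absN ?ab // ge_max lexx ltW.
- have /eqP a1 : abs a == 1 by rewrite -sqrp_eq1 // expr2 {2}ad ad1.
  case: nonint; move: bd ca; rewrite -ad a1 lexx => /ltW -> /ltW -> //.
Qed.

Lemma nonintegral_displacement M : \det M = 1 -> ~ integral_mx M ->
  exists2 x, x != 0 & chordal abs (proj (M *m x)) (proj x) = 1.
Proof.
move=> detM nonint.
suff [x [x0 x1 le]] : exists x,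
    [/\ x != 0, vnorm x = 1 & vnorm (M *m x) <= abs (wedge (M *m x) x)].
  exists x => //; apply/eqP; rewrite eq_le (chordal_le1 habs) /=.
  rewrite chordal_proj ?det1_mulmx_neq0 // x1 mulr1.
  by rewrite ler_pdivlMr ?mul1r // vnorm_gt0 // det1_mulmx_neq0.
(* The coordinates (1, 0), (0, 1) and (1, 1) of the points oo, 0 and 1. *)
have ex s t : [\/ s = 1 /\ t = 0, s = 0 /\ t = 1 | s = 1 /\ t = 1] ->
    Num.max (abs (M 0 0 * s + M 0 1 * t)) (abs (M 1 0 * s + M 1 1 * t)) <=
    abs ((M 0 0 * s + M 0 1 * t) * t - (M 1 0 * s + M 1 1 * t) * s) ->
    exists x, [/\ x != 0, vnorm x = 1 & vnorm (M *m x) <= abs (wedge (M *m x) x)].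
  move=> st le; exists (colvec s t); split.
  - apply: colvec_neq0.
    by case: st => -[-> ->]; rewrite oner_eq0 ?orbT.
  - rewrite /vnorm !mxE /=.
    by case: st => -[-> ->]; rewrite ?abs0 ?abs1 ?maxxx //;
      [apply/max_idPl|apply/max_idPr].
  - by rewrite /vnorm /wedge !mulmx2E !mxE /=.
have := @nonintegral_entries (M 0 0) (M 0 1) (M 1 0) (M 1 1).
rewrite -det_mx22 => /(_ detM)[|le|le|le].
- case=> h00 [h11 [h01 h10]]; apply: nonint => i j.
  by case: i => [[|[|[]]]] //= hi; case: j => [[|[|[]]]] //= hj;
    [move: h00|move: h01|move: h10|move: h11];
    congr (abs (M _ _) <= 1); apply: val_inj.
- apply: (ex 1 0); first by constructor 1.
  by rewrite !(mulr1, mulr0, addr0, sub0r) absN ge_max le lexx.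
- apply: (ex 0 1); first by constructor 2.
  by rewrite !(mulr1, mulr0, add0r, subr0) ge_max le lexx.
- apply: (ex 1 1); first by constructor 3.
  by rewrite !mulr1.
Qed.

(** * Distances between Moebius maps *)

Lemma det_SL2 (A : SL2 C) : \det (val A) = 1.
Proof. exact/eqP/(valP A). Qed.

Lemma rho0_bounded (g h : PSL2 C) :
  has_ubound [set chordal abs (PSL2_act g z) (PSL2_act h z) | z in [set: P1 C]].
Proof. by exists 1 => _ [z _ <-]; exact: chordal_le1. Qed.

Lemma rho0_ge (g h : PSL2 C) z :
  chordal abs (PSL2_act g z) (PSL2_act h z) <= rho0 abs g h.
Proof. by apply: ub_le_sup; [exact: rho0_bounded|exists z]. Qed.

Lemma rho0_ge0 (g h : PSL2 C) : 0 <= rho0 abs g h.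
Proof. exact: le_trans (chordal_ge0 habs _ _) (rho0_ge g h None). Qed.

Lemma rho0_le1 (g h : PSL2 C) : rho0 abs g h <= 1.
Proof.
apply: ge_sup; first by exists (chordal abs (PSL2_act g None) (PSL2_act h None)), None.
by move=> _ [z _ <-]; exact: chordal_le1.
Qed.

Lemma chordal_refl z : chordal abs z z = 0.
Proof. by case: z => [z|] //=; rewrite subrr abs0 mul0r. Qed.

Lemma rho0_refl (g : PSL2 C) : rho0 abs g g = 0.
Proof.
apply/eqP; rewrite eq_le rho0_ge0 andbT; apply: ge_sup.
  by exists (chordal abs (PSL2_act g None) (PSL2_act g None)), None.
by move=> _ [z _ <-]; rewrite chordal_refl.
Qed.

(** The isometry [u] is cancelled by writing a nonintegral lift of [g] as
    [B M] with [B] a lift of [u]; [M] is then nonintegral too, and the point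
    that it displaces by 1 realizes the supremum. *)
Lemma rho0_nonintegral (g u : PSL2 C) :
  ~ PSL2O abs g -> PSL2O abs u -> rho0 abs g u = 1.
Proof.
move=> /existsNP[A /not_implyP[gA nonintA]] hu.
have uB : to_PSL2 (repr u) = u by exact: reprK.
have intB : integral_mx (val (repr u)) := hu _ uB.
set B := val (repr u) in intB.
have detB : \det B = 1 by exact: det_SL2.
pose M := \adj B *m val A.
have AM : val A = B *m M by rewrite /M mulmxA mul_mx_adj detB mul1mx.
have detM : \det M = 1.
  by have := det_SL2 A; rewrite AM det_mulmx detB mul1r.
have nonintM : ~ integral_mx M.
  by move=> intM; apply: nonintA => i j; rewrite AM; apply: integral_mulmx.
have [x x0 dx] := nonintegral_displacement detM nonintM.
apply/eqP; rewrite eq_le rho0_le1 /=.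
apply: le_trans (rho0_ge g u (proj x)).
rewrite -gA -uB !PSL2_actE !mobius_proj // AM -mulmxA.
by rewrite chordal_integral_isometry ?dx // det1_mulmx_neq0.
Qed.

Lemma PSL2O_nonempty : PSL2O abs !=set0.
Proof.
have det1 : \det (1%:M : 'M[C]_2) == 1 by rewrite det1.
exists (to_PSL2 (exist (fun A : 'M[C]_2 => \det A == 1) _ det1 : SL2 C)) => A /to_PSL2_eq hA i j.
have le1 : abs ((1%:M : 'M[C]_2) i j) <= 1.
  by rewrite mxE; case: eqP; rewrite ?abs0 ?abs1 ?ler01.
case: hA => /= ->; first exact: le1.
by rewrite mxE absN; exact: le1.
Qed.

Lemma dist_to_PSL2O (g : PSL2 C) :
  (PSL2O abs g -> dist_to abs g (PSL2O abs) = 0) /\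
  (~ PSL2O abs g -> dist_to abs g (PSL2O abs) = 1).
Proof.
split=> hg; rewrite /dist_to.
  have lb0 : lbound [set rho0 abs g u | u in PSL2O abs] 0.
    by move=> _ [u _ <-]; exact: rho0_ge0.
  have in0 : [set rho0 abs g u | u in PSL2O abs] 0.
    by exists g => //; exact: rho0_refl.
  apply/eqP; rewrite eq_le; apply/andP; split.
    by apply: ge_inf => //; exists 0.
  by apply: lb_le_inf => //; exists 0.
suff -> : [set rho0 abs g u | u in PSL2O abs] = [set 1] by exact: inf1.
apply/seteqP; split=> [_ [u hu <-]|_ ->] /=; first exact: rho0_nonintegral.
by have [u hu] := PSL2O_nonempty; exists u => //; exact: rho0_nonintegral.
Qed.

End Nonarchimedean.

Theorem theorem1p9 (R : realType) (p : nat) (hp : prime p)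
    (Cp : fieldType) (abs : Cp -> R) (hCp : is_padic_complex p abs)
    (g : PSL2 Cp) :
  (PSL2O abs g -> dist_to abs g (PSL2O abs) = 0) /\
  (~ PSL2O abs g -> dist_to abs g (PSL2O abs) = 1).
Proof.
have habs : nonarch_abs abs.
  by case: hCp => ? [? [? [_ [? [? [? [_ _ _ [k /completion_abs]]]]]]]].
exact: dist_to_PSL2O.
Qed.
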